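(* $$6\sqrt{2} = \sum_{k=0}^{\infty}\left(-\frac14\right)^{k}\frac{\left(\frac18\right)_k\left(\frac58\right)_k\left(\frac34\right)_k}{\left(\frac78\right)_k(1)_k\left(\frac{11}{8}\right)_k}\,(40k+9).$$
   Context: For $k\in\mathbb{N}_0$, $(\alpha)_k=\alpha(\alpha+1)\cdots(\alpha+k-1)$ is the rising factorial (Pochhammer symbol), with $(\alpha)_0=1$. *)

(* Defs.v *)
(* Stdlib's real numbers, with Coquelicot for series. *)
From Stdlib Require Import Reals.
From Coquelicot Require Import Coquelicot.

Open Scope R_scope.

(* Rising factorial a (a + 1) ... (a + k - 1). *)
Fixpoint pochhammer (a : R) (k : nat) : R :=
  match k with
  | O => 1
  | S j => pochhammer a j * (a + INR j)
  end.

(* Main.v *)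
Require Import Defs.
From Stdlib Require Import Reals Lra Lia.
From Corelib Require Import ssreflect.
From Coquelicot Require Import Coquelicot.

Open Scope R_scope.

(* Up to the factor 1 / 4^k, (1/8)_k (5/8)_k = (1/4)_(2k) and (7/8)_k (11/8)_k = (7/4)_(2k), so the
   terms are combinations of the Beta moments of x^(-3/4) (1 - x)^(-1/2) on [0, 1].  Summing the
   binomial series of (1 + x^2/4)^(-3/4) under the integral reduces the claim to
     int_0^1 (2 + 3 x) x^(-3/4) (1 - x)^(-1/2) (4 + x^2)^(-3/4) dx = B(1/4, 1/2).
   The rational substitution s = 4 x / ((4 + x^2) (1 - x)^2) maps [0, 1) onto [0, oo) and turns the
   left-hand side into int_0^oo s^(-3/4) (1 + s)^(-1/2) ds, up to a constant.  Writing s = q^4, the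
   symmetry q -> 1/q folds this onto [0, 1], where x = 4 r^4 / (1 + r^4)^2 brings B(1/4, 1/2) to the
   same integral L = int_0^1 (1 + r^4)^(-1/2) dr. *)


(** * The weight [phi], the substitution [amp] and the Beta moments *)

Definition phi (r : R) : R := / sqrt (1 + r ^ 4).
(* The substitution x = amp r turns x^(-3/4) (1 - x)^(-1/2) dx on [0, 1] into 4 sqrt 2 phi r dr,
   which has no endpoint singularity. *)
Definition amp (r : R) : R := 4 * r ^ 4 / (1 + r ^ 4) ^ 2.

Lemma one_plus_pow4_pos (r : R) : 0 < 1 + r ^ 4.
Proof. pose proof (pow2_ge_0 (r ^ 2)). nra. Qed.

Lemma sqrt_one_plus_pow4_pos (r : R) : 0 < sqrt (1 + r ^ 4).
Proof. apply sqrt_lt_R0, one_plus_pow4_pos. Qed.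

Lemma sqr_sqrt_one_plus_pow4 (r : R) : sqrt (1 + r ^ 4) ^ 2 = 1 + r ^ 4.
Proof. apply pow2_sqrt, Rlt_le, one_plus_pow4_pos. Qed.

Lemma amp_ge0 (r : R) : 0 <= amp r.
Proof.
unfold amp. pose proof (one_plus_pow4_pos r).
apply Rdiv_le_0_compat; [|apply pow_lt; lra].
pose proof (pow2_ge_0 (r ^ 2)). nra.
Qed.

(** Since (1 + r^4)^2 - 4 r^4 = (1 - r^4)^2, the square root of 1 - x becomes rational in r. *)
Lemma one_minus_amp (r : R) : 1 - amp r = ((1 - r ^ 4) / (1 + r ^ 4)) ^ 2.
Proof. unfold amp. pose proof (one_plus_pow4_pos r). field. simpl in *; lra. Qed.

Lemma amp_le1 (r : R) : amp r <= 1.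
Proof. pose proof (pow2_ge_0 ((1 - r ^ 4) / (1 + r ^ 4))). rewrite <- one_minus_amp in H. lra. Qed.

Lemma is_derive_Rmult (f g : R -> R) (x df dg : R) :
  is_derive f x df -> is_derive g x dg ->
  is_derive (fun t => f t * g t) x (df * g x + f x * dg).
Proof. intros Hf Hg. apply (is_derive_mult f g); auto. intros; apply Rmult_comm. Qed.

Lemma is_derive_amp (r : R) :
  is_derive amp r (16 * r ^ 3 * (1 - r ^ 4) / (1 + r ^ 4) ^ 3).
Proof.
pose proof (one_plus_pow4_pos r). unfold amp. auto_derive.
- simpl in *; nra.
- field. simpl in *; lra.
Qed.

Lemma is_derive_sqrt_one_plus_pow4 (r : R) :
  is_derive (fun t => sqrt (1 + t ^ 4)) r (2 * r ^ 3 / sqrt (1 + r ^ 4)).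
Proof.
pose proof (one_plus_pow4_pos r). pose proof (sqrt_one_plus_pow4_pos r). auto_derive.
- assumption.
- simpl in *. field. lra.
Qed.

Lemma is_derive_phi (r : R) :
  is_derive phi r (- (2 * r ^ 3) / (1 + r ^ 4) * phi r).
Proof.
pose proof (sqrt_one_plus_pow4_pos r).
evar_last. { apply is_derive_inv. apply is_derive_sqrt_one_plus_pow4. lra. }
cbv beta. unfold phi. rewrite <- sqr_sqrt_one_plus_pow4 at 3. field. lra.
Qed.

Lemma continuous_of_is_derive (f : R -> R) (x l : R) : is_derive f x l -> continuous f x.
Proof. intros H. apply: ex_derive_continuous. now exists l. Qed.

Lemma continuous_phi (r : R) : continuous phi r.
Proof. eapply continuous_of_is_derive, is_derive_phi. Qed.

Lemma continuous_amp (r : R) : continuous amp r.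
Proof. eapply continuous_of_is_derive, is_derive_amp. Qed.

Lemma continuous_pow (f : R -> R) (n : nat) (r : R) :
  continuous f r -> continuous (fun t => f t ^ n) r.
Proof.
intros H. induction n as [|n IH]; simpl.
- apply continuous_const.
- now apply (continuous_mult f (fun t => f t ^ n)).
Qed.

Lemma ex_RInt_of_continuous (f : R -> R) (a b : R) : (forall r, continuous f r) -> ex_RInt f a b.
Proof. intros H. apply: ex_RInt_continuous. auto. Qed.

(** This is B(m + 1/4, 1/2) / (4 sqrt 2), by x = [amp r]. *)
Definition moment (m : nat) : R := RInt (fun r => amp r ^ m * phi r) 0 1.

Lemma continuous_moment (m : nat) (r : R) : continuous (fun t => amp t ^ m * phi t) r.
Proof.
apply (continuous_mult (fun t => amp t ^ m) phi).
- apply continuous_pow, continuous_amp.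
- apply continuous_phi.
Qed.

Lemma is_RInt_moment (m : nat) : is_RInt (fun r => amp r ^ m * phi r) 0 1 (moment m).
Proof. apply: RInt_correct. apply ex_RInt_of_continuous, continuous_moment. Qed.

(** On [0, 1] the primitive is x^(m + 1/4) (1 - x)^(1/2) / sqrt 2 with x = [amp t], the usual choice
    for integrating a Beta integral by parts. *)
Lemma is_derive_moment_primitive (m : nat) (r : R) :
  is_derive (fun t => amp t ^ m * (t * (1 - t ^ 4) / (1 + t ^ 4) * phi t)) r
    ((4 * INR m + 1) * (amp r ^ m * phi r) - (4 * INR m + 3) * (amp r ^ S m * phi r)).
Proof.
pose proof (one_plus_pow4_pos r).
evar_last.
{ apply is_derive_Rmult.
  - apply is_derive_pow, is_derive_amp.
  - apply (is_derive_Rmult (fun t => t * (1 - t ^ 4) / (1 + t ^ 4)) phi).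
    + instantiate (1 := (1 - 8 * r ^ 4 - r ^ 8) / (1 + r ^ 4) ^ 2).
      auto_derive; [simpl in *; lra|field; simpl in *; lra].
    + apply is_derive_phi. }
(* The derivative of [amp t ^ m] carries the exponent [pred m], hence the case split. *)
cbv beta. destruct m as [|j].
- simpl. unfold amp. field. simpl in *; lra.
- rewrite S_INR. simpl pred. rewrite <- !tech_pow_Rmult.
  generalize (amp r ^ j); intros A. unfold amp. field. simpl in *; lra.
Qed.

(** The primitive vanishes at both ends: its factor t at 0, its factor 1 - t^4 at 1. *)
Lemma moment_recurrence (m : nat) :
  (4 * INR m + 3) * moment (S m) = (4 * INR m + 1) * moment m.
Proof.
assert (H : is_RInt (fun r => (4 * INR m + 1) * (amp r ^ m * phi r)
                    - (4 * INR m + 3) * (amp r ^ S m * phi r)) 0 1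
              ((4 * INR m + 1) * moment m - (4 * INR m + 3) * moment (S m))).
{ apply: is_RInt_minus; apply: is_RInt_scal; apply is_RInt_moment. }
assert (H' := is_RInt_derive _ _ 0 1 (fun r _ => is_derive_moment_primitive m r)
  (fun r _ => continuous_minus _ _ r
     (continuous_scal_r (4 * INR m + 1) _ r (continuous_moment m r))
     (continuous_scal_r (4 * INR m + 3) _ r (continuous_moment (S m) r)))).
apply (is_RInt_unique (V := R_CompleteNormedModule)) in H.
apply (is_RInt_unique (V := R_CompleteNormedModule)) in H'.
pose proof (eq_trans (eq_sym H) H') as E. clear H H'.
revert E. simpl (1 - 1 ^ 4). unfold minus, plus, opp ; simpl. intros E. lra.
Qed.


(** * The rational substitution, through its fourth root and the reciprocal of that root *)

Lemma phi_pos (r : R) : 0 < phi r.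
Proof. apply Rinv_0_lt_compat, sqrt_one_plus_pow4_pos. Qed.

Lemma pow2_phi (r : R) : phi r ^ 2 = / (1 + r ^ 4).
Proof. unfold phi. rewrite pow_inv sqr_sqrt_one_plus_pow4. reflexivity. Qed.

(** Evaluates [phi] at substituted points, where 1 + y^4 is the square of an explicit expression. *)
Lemma phi_eq_of_square (y z : R) : 0 < z -> 1 + y ^ 4 = z ^ 2 -> phi y = / z.
Proof. intros Hz H. unfold phi. rewrite H sqrt_pow2; lra. Qed.

(** The cube is the weight (1 + x^2/4)^(-3/4) of the binomial series; the first power enters the
    fourth root of s. *)
Definition root (x : R) : R := Rpower (1 + x ^ 2 / 4) (- (1 / 4)).

Lemma base_pos (x : R) : 0 < 1 + x ^ 2 / 4.
Proof. pose proof (pow2_ge_0 x). lra. Qed.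

Lemma root_pos (x : R) : 0 < root x.
Proof. apply exp_pos. Qed.

Lemma pow4_root (x : R) : root x ^ 4 = / (1 + x ^ 2 / 4).
Proof.
unfold root. rewrite <- Rpower_pow by apply exp_pos. rewrite Rpower_mult.
replace (- (1 / 4) * INR 4) with (- (1)) by (simpl; field).
rewrite Rpower_Ropp Rpower_1 //. apply base_pos.
Qed.

Lemma is_derive_root (x : R) : is_derive root x (- (x / (2 * (4 + x ^ 2))) * root x).
Proof.
pose proof (base_pos x). unfold root, Rpower. auto_derive.
- assumption.
- simpl in *. unfold Rdiv. field. unfold Rdiv in *; lra.
Qed.

Lemma is_derive_root_amp (r : R) :
  is_derive (fun t => root (amp t)) r
    (16 * r ^ 3 * (1 - r ^ 4) / (1 + r ^ 4) ^ 3
     * (- (amp r / (2 * (4 + amp r ^ 2))) * root (amp r))).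
Proof. apply (is_derive_comp root amp); [apply is_derive_root|apply is_derive_amp]. Qed.

(* subst0 r is the positive fourth root of 4 x / ((4 + x^2) (1 - x)^2), x = amp r, and
   subst1 r = 1 / subst0 r; the former is used near r = 0, the latter near r = 1. *)
Definition subst0 (r : R) : R :=
  sqrt 2 * (r * (1 + r ^ 4) / (1 - r ^ 4)) * (phi r * root (amp r)).

(** The derivative of [subst0], factored so that x^2 - x + 2 (x = [amp r]) cancels against
    [phi (subst0 r)]. *)
Definition dsubst0 (r : R) : R :=
  sqrt 2 / 4 * ((3 * amp r + 2) * (amp r ^ 2 - amp r + 2) / (1 + amp r ^ 2 / 4))
  * ((1 + r ^ 4) / (1 - r ^ 4)) ^ 2 * (phi r * root (amp r)).

Definition subst1 (r : R) : R :=
  sqrt 2 / 2 * ((1 - r ^ 4) / r) * (phi r * / root (amp r)).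

Definition dsubst1 (r : R) : R :=
  - (sqrt 2 / 8) * ((3 * amp r + 2) * (amp r ^ 2 - amp r + 2) / (1 + amp r ^ 2 / 4))
  * ((1 + r ^ 4) / r ^ 2) * (phi r * / root (amp r)).

(** The numerator of 1 + x^2/4, x = [amp r], after clearing denominators, shaped for the side
    conditions of [field]. *)
Lemma amp_base_neq0 (r : R) :
  4 * ((1 + r ^ 4) ^ 2) ^ 2 + (4 * r ^ 4) ^ 2 <> 0.
Proof.
pose proof (one_plus_pow4_pos r). apply Rgt_not_eq.
pose proof (pow_lt _ 2 (pow_lt _ 2 H)). pose proof (pow2_ge_0 (4 * r ^ 4)). lra.
Qed.

Lemma is_derive_subst0 (r : R) : 1 - r ^ 4 <> 0 -> is_derive subst0 r (dsubst0 r).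
Proof.
intros Hr. pose proof (one_plus_pow4_pos r).
unfold subst0. evar_last.
{ apply is_derive_Rmult.
  - instantiate (1 := sqrt 2 * (1 + 8 * r ^ 4 - r ^ 8) / (1 - r ^ 4) ^ 2).
    auto_derive; [simpl in *; lra|simpl in *; field; lra].
  - apply is_derive_Rmult; [apply is_derive_phi|apply is_derive_root_amp]. }
cbv beta. unfold dsubst0. generalize (root (amp r)); intros e.
pose proof (amp_base_neq0 r).
unfold amp. field. repeat split; simpl in *; try lra.
Qed.

Lemma is_derive_subst1 (r : R) : r <> 0 -> is_derive subst1 r (dsubst1 r).
Proof.
intros Hr. pose proof (one_plus_pow4_pos r). pose proof (root_pos (amp r)).
unfold subst1. evar_last.
{ apply is_derive_Rmult.
  - instantiate (1 := sqrt 2 / 2 * (- (1 + 3 * r ^ 4) / r ^ 2)).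
    auto_derive; [simpl in *; lra|simpl in *; field; lra].
  - apply is_derive_Rmult; [apply is_derive_phi|].
    apply (is_derive_inv (fun t => root (amp t))); [apply is_derive_root_amp|lra]. }
cbv beta. unfold dsubst1. revert H0. generalize (root (amp r)); intros e He.
pose proof (amp_base_neq0 r).
unfold amp. field. repeat split; simpl in *; try lra.
Qed.

Lemma quadratic_amp_pos (r : R) : 0 < amp r ^ 2 - amp r + 2.
Proof. nra. Qed.

Lemma sqrt2_pow4 : sqrt 2 ^ 4 = 4.
Proof.
replace (sqrt 2 ^ 4) with ((sqrt 2 ^ 2) ^ 2) by ring. rewrite pow2_sqrt; lra.
Qed.

Lemma phi_pow4 (r : R) : phi r ^ 4 = / (1 + r ^ 4) ^ 2.
Proof. rewrite -pow_inv -pow2_phi. ring. Qed.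

Lemma pow4_subst0 (r : R) : 1 - r ^ 4 <> 0 ->
  subst0 r ^ 4 = amp r * ((1 + r ^ 4) / (1 - r ^ 4)) ^ 4 / (1 + amp r ^ 2 / 4).
Proof.
intros Hr. pose proof (one_plus_pow4_pos r). pose proof (amp_base_neq0 r).
unfold subst0.
rewrite (Rpow_mult_distr (_ * _)) (Rpow_mult_distr (sqrt 2)) (Rpow_mult_distr (phi r)).
rewrite sqrt2_pow4 phi_pow4 pow4_root.
unfold amp. field. repeat split; simpl in *; try lra.
Qed.

Lemma pow4_subst1 (r : R) : r <> 0 ->
  subst1 r ^ 4 = / amp r * ((1 - r ^ 4) / (1 + r ^ 4)) ^ 4 * (1 + amp r ^ 2 / 4).
Proof.
intros Hr. pose proof (one_plus_pow4_pos r). pose proof (amp_base_neq0 r).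
unfold subst1. replace (sqrt 2 / 2) with (sqrt 2 * / 2) by reflexivity.
rewrite (Rpow_mult_distr (_ * _)) (Rpow_mult_distr (sqrt 2 * _)) (Rpow_mult_distr (sqrt 2)) (Rpow_mult_distr (phi r)).
rewrite sqrt2_pow4 phi_pow4 pow_inv pow_inv pow4_root.
unfold amp. field. repeat split; simpl in *; try lra.
Qed.

(* With q = subst0 r and x = amp r, the identity (4 + x^2) (1 - x)^2 + 4 x = (x^2 - x + 2)^2 makes
   1 + q^4 = (x^2 - x + 2)^2 / ((4 + x^2) (1 - x)^2) a square. *)
Lemma phi_subst0 (r : R) : 1 - r ^ 4 <> 0 ->
  dsubst0 r * phi (subst0 r)
  = sqrt 2 / 2 * ((3 * amp r + 2) * root (amp r) ^ 3 * phi r).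
Proof.
intros Hr. pose proof (one_plus_pow4_pos r) as Hp. pose proof (root_pos (amp r)) as He.
pose proof (quadratic_amp_pos r) as Hq. pose proof (base_pos (amp r)) as Hb.
pose proof (amp_base_neq0 r) as Hz.
assert (H2 : 0 < (1 - r ^ 4) ^ 2) by now apply pow2_gt_0.
(* The root of 1 + q^4, using 4 + x^2 = 4 / [root x] ^ 4 and 1 - x = ((1 - r^4) / (1 + r^4))^2. *)
rewrite (phi_eq_of_square _
  ((amp r ^ 2 - amp r + 2) * (1 + r ^ 4) ^ 2 * root (amp r) ^ 2 / (2 * (1 - r ^ 4) ^ 2))).
- unfold dsubst0.
  replace (/ (1 + amp r ^ 2 / 4)) with (root (amp r) ^ 4) by apply pow4_root.
  unfold Rdiv at 2. rewrite -pow4_root. field. repeat split; simpl in *; try lra.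
- apply Rdiv_lt_0_compat; [|lra].
  apply Rmult_lt_0_compat; [|now apply pow_lt].
  apply Rmult_lt_0_compat; [easy|now apply pow_lt].
- rewrite (pow4_subst0 _ Hr).
  replace (((amp r ^ 2 - amp r + 2) * (1 + r ^ 4) ^ 2 * root (amp r) ^ 2 / (2 * (1 - r ^ 4) ^ 2)) ^ 2)
    with (((amp r ^ 2 - amp r + 2) * (1 + r ^ 4) ^ 2 / (2 * (1 - r ^ 4) ^ 2)) ^ 2 * root (amp r) ^ 4)
    by (field; simpl in *; lra).
  rewrite pow4_root. unfold amp. field. repeat split; simpl in *; try lra.
Qed.

(** With p = [subst1 r] = 1/q, 1 + p^4 = (x^2 - x + 2)^2 / (4 x), and 4 x = (4 r^2 / (1 + r^4))^2 is
    a square too. The sign is negative because [subst1] decreases. *)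
Lemma phi_subst1 (r : R) : 0 < r ->
  dsubst1 r * phi (subst1 r)
  = - (sqrt 2 / 2 * ((3 * amp r + 2) * root (amp r) ^ 3 * phi r)).
Proof.
intros Hr. pose proof (one_plus_pow4_pos r) as Hp. pose proof (root_pos (amp r)) as He.
pose proof (quadratic_amp_pos r) as Hq. pose proof (base_pos (amp r)) as Hb.
pose proof (amp_base_neq0 r) as Hz.
assert (H2 : 0 < r ^ 2) by now apply pow_lt.
rewrite (phi_eq_of_square _
  ((amp r ^ 2 - amp r + 2) * (1 + r ^ 4) / (4 * r ^ 2))).
- unfold dsubst1.
  unfold Rdiv at 2. rewrite -pow4_root. field. repeat split; simpl in *; try lra.
- apply Rdiv_lt_0_compat; [|lra]. now apply Rmult_lt_0_compat.
- rewrite pow4_subst1 //; [|lra].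
  unfold amp. field. repeat split; simpl in *; try lra.
Qed.


(** * Real integration rules and the inversion symmetry of [phi] *)

Lemma RInt_comp_R (f g dg : R -> R) (a b : R) :
  (forall x, continuous f x) ->
  (forall x, Rmin a b <= x <= Rmax a b -> is_derive g x (dg x) /\ continuous dg x) ->
  RInt (fun t => dg t * f (g t)) a b = RInt f (g a) (g b).
Proof. intros Hf Hg. apply (RInt_comp (V := R_CompleteNormedModule) f g dg a b); auto. Qed.

Lemma RInt_ext_R (f g : R -> R) (a b : R) :
  (forall x, Rmin a b < x < Rmax a b -> f x = g x) -> RInt f a b = RInt g a b.
Proof. apply (RInt_ext (V := R_CompleteNormedModule)). Qed.

Lemma RInt_Chasles_continuous (f : R -> R) (a b c : R) :
  (forall x, continuous f x) -> RInt f a b + RInt f b c = RInt f a c.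
Proof.
intros Hf. apply (RInt_Chasles (V := R_CompleteNormedModule)); now apply ex_RInt_of_continuous.
Qed.

Lemma RInt_scal_continuous (f : R -> R) (k a b : R) :
  (forall x, continuous f x) -> RInt (fun t => k * f t) a b = k * RInt f a b.
Proof.
intros Hf. apply (RInt_scal (V := R_CompleteNormedModule)); now apply ex_RInt_of_continuous.
Qed.

(** The factor t^2 cancels the Jacobian -1/t^2 of the inversion, so [phi t] dt only changes sign. *)
Lemma phi_inv (t : R) : 0 < t -> phi (/ t) = t ^ 2 * phi t.
Proof.
intros Ht. pose proof (sqrt_one_plus_pow4_pos t). pose proof (sqr_sqrt_one_plus_pow4 t) as E.
assert (0 < t ^ 2) by now apply pow_lt.
rewrite (phi_eq_of_square _ (sqrt (1 + t ^ 4) / t ^ 2)).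
- unfold phi. field. lra.
- now apply Rdiv_lt_0_compat.
- unfold Rdiv. rewrite Rpow_mult_distr E. field. lra.
Qed.

(** By inversion the integrals from 1 to y and from 1 to 1/y are opposite. This finite form of the
    folding avoids an improper integral over [0, oo). *)
Lemma RInt_phi_add_inv (y : R) : 0 < y ->
  RInt phi 0 y + RInt phi 0 (/ y) = 2 * RInt phi 0 1.
Proof.
intros Hy.
assert (Hpos : forall x, Rmin 1 y <= x <= Rmax 1 y -> 0 < x).
{ intros x [Hx _]. apply Rlt_le_trans with (2 := Hx). apply Rmin_glb_lt; lra. }
assert (H : RInt (fun t => - / t ^ 2 * phi (/ t)) 1 y = RInt phi (/ 1) (/ y)).
{ apply (RInt_comp_R phi Rinv (fun t => - / t ^ 2)).
  - apply continuous_phi.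
  - intros x Hx. apply Hpos in Hx. split.
    + auto_derive; [lra|field; lra].
    + apply (ex_derive_continuous (fun t => - / t ^ 2)). auto_derive. nra. }
rewrite (RInt_ext_R _ (fun t => -1 * phi t)) in H.
2: { intros x [Hx _]. assert (0 < x) by (apply Rlt_trans with (2 := Hx); apply Rmin_glb_lt; lra).
  rewrite phi_inv //. field. lra. }
rewrite RInt_scal_continuous in H; [|apply continuous_phi].
rewrite Rinv_1 in H.
rewrite -(RInt_Chasles_continuous phi 0 1 y); [|apply continuous_phi].
rewrite -(RInt_Chasles_continuous phi 0 1 (/ y)); [|apply continuous_phi].
lra.
Qed.

(** * Evaluation of the main integral in the variable r *)

Definition integrand (r : R) : R := (3 * amp r + 2) * root (amp r) ^ 3 * phi r.

Lemma ex_derive_amp (r : R) : ex_derive amp r.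
Proof. eexists; apply is_derive_amp. Qed.

Lemma ex_derive_phi (r : R) : ex_derive phi r.
Proof. eexists; apply is_derive_phi. Qed.

Lemma ex_derive_root (r : R) : ex_derive root r.
Proof. eexists; apply is_derive_root. Qed.

Lemma continuous_integrand (r : R) : continuous integrand r.
Proof.
apply (ex_derive_continuous integrand). unfold integrand.
auto_derive. repeat split; auto using ex_derive_amp, ex_derive_phi, ex_derive_root.
Qed.

Lemma continuous_dsubst0 (r : R) : 1 - r ^ 4 <> 0 -> continuous dsubst0 r.
Proof.
intros Hr. pose proof (base_pos (amp r)).
apply (ex_derive_continuous dsubst0). unfold dsubst0.
auto_derive. repeat split; auto using ex_derive_amp, ex_derive_phi, ex_derive_root;
  simpl in *; lra.
Qed.

Lemma continuous_dsubst1 (r : R) : r <> 0 -> continuous dsubst1 r.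
Proof.
intros Hr. pose proof (base_pos (amp r)). pose proof (root_pos (amp r)).
apply (ex_derive_continuous dsubst1). unfold dsubst1.
auto_derive. repeat split; auto using ex_derive_amp, ex_derive_phi, ex_derive_root;
  simpl in *; try lra.
Qed.

Lemma pow4_lt1 (r : R) : 0 <= r <= 1 / 2 -> 0 < 1 - r ^ 4.
Proof. intros Hr. assert (r ^ 4 <= (1 / 2) ^ 4) by now apply pow_incr. lra. Qed.

(** [subst0] has its pole at r = 1, so it is used only up to the cut 1/2; it sends 0 to 0. *)
Lemma RInt_integrand_left :
  sqrt 2 / 2 * RInt integrand 0 (1 / 2) = RInt phi 0 (subst0 (1 / 2)).
Proof.
rewrite -RInt_scal_continuous; [|apply continuous_integrand].
replace 0 with (subst0 0) at 2 by (unfold subst0; field).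
rewrite -(RInt_comp_R phi subst0 dsubst0).
- apply RInt_ext_R. intros x. rewrite Rmin_left ?Rmax_right; try lra. intros Hx.
  rewrite phi_subst0 //. apply Rgt_not_eq, pow4_lt1. lra.
- apply continuous_phi.
- intros x. rewrite Rmin_left ?Rmax_right; try lra. intros Hx%pow4_lt1.
  split; [apply is_derive_subst0|apply continuous_dsubst0]; lra.
Qed.

(** [subst1] is singular at 0 but regular on [1/2, 1], and it sends 1 to 0. Reversing the limits
    absorbs the minus sign of [phi_subst1]. *)
Lemma RInt_integrand_right :
  sqrt 2 / 2 * RInt integrand (1 / 2) 1 = RInt phi 0 (subst1 (1 / 2)).
Proof.
assert (H : RInt (fun t => dsubst1 t * phi (subst1 t)) (1 / 2) 1
            = RInt phi (subst1 (1 / 2)) (subst1 1)).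
{ apply RInt_comp_R.
  - apply continuous_phi.
  - intros x. rewrite Rmin_left ?Rmax_right; try lra. intros Hx.
    split; [apply is_derive_subst1|apply continuous_dsubst1]; lra. }
replace (subst1 1) with 0 in H by (unfold subst1; field; apply Rgt_not_eq, root_pos).
rewrite (RInt_ext_R _ (fun t => - (sqrt 2 / 2) * integrand t)) in H.
2: { intros x. rewrite Rmin_left ?Rmax_right; try lra. intros Hx.
  rewrite phi_subst1; [|lra]. unfold integrand. ring. }
rewrite RInt_scal_continuous in H; [|apply continuous_integrand].
pose proof (RInt_Chasles_continuous phi 0 (subst1 (1 / 2)) 0 continuous_phi) as E.
pose proof (RInt_point (V := R_CompleteNormedModule) 0 phi) as E0.
unfold zero in E0; simpl in E0. rewrite E0 in E. lra.
Qed.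

(** The upper limits of the two halves are reciprocal, so [RInt_phi_add_inv] adds them and the cut
    1/2 drops out. *)
Lemma RInt_integrand : RInt integrand 0 1 = 2 * sqrt 2 * RInt phi 0 1.
Proof.
assert (H0 : 0 < subst0 (1 / 2)).
{ pose proof (phi_pos (1 / 2)). pose proof (root_pos (amp (1 / 2))). pose proof Rlt_sqrt2_0.
  unfold subst0. apply Rmult_lt_0_compat; [|nra]. apply Rmult_lt_0_compat; lra. }
assert (H1 : subst1 (1 / 2) = / subst0 (1 / 2)).
{ pose proof (phi_pos (1 / 2)). pose proof (root_pos (amp (1 / 2))). pose proof Rlt_sqrt2_0.
  pose proof (pow2_phi (1 / 2)) as E. pose proof (pow2_sqrt 2) as E2.
  apply Rmult_eq_reg_r with (subst0 (1 / 2)); [|lra]. rewrite Rinv_l; [|lra].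
  unfold subst0, subst1.
  (* In the product, r, 1 - r^4 and [root] cancel at r = 1/2; what is left is 1, as (1 + r^4)
     [phi r] ^ 2 = 1. *)
  transitivity (sqrt 2 ^ 2 / 2 * ((1 + (1 / 2) ^ 4) * phi (1 / 2) ^ 2)).
  - field. lra.
  - rewrite E E2; [|lra]. field. }
pose proof (RInt_phi_add_inv _ H0) as H. rewrite -H1 -RInt_integrand_left -RInt_integrand_right in H.
pose proof (RInt_Chasles_continuous integrand 0 (1 / 2) 1 continuous_integrand) as E.
pose proof (pow2_sqrt 2 ltac:(lra)) as E2.
rewrite -E. set (A := RInt integrand 0 _) in *. set (B := RInt integrand _ 1) in *.
change (@eq R (A + B) (2 * sqrt 2 * RInt phi 0 1)).
transitivity (sqrt 2 ^ 2 / 2 * (A + B)); [rewrite E2; field|].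
transitivity (sqrt 2 * (sqrt 2 / 2 * A + sqrt 2 / 2 * B)); [field|].
rewrite H. ring.
Qed.


(** * The binomial series of (1 + y)^(-c) and its error *)

Lemma pochhammer_pos (a : R) (k : nat) : 0 < a -> 0 < pochhammer a k.
Proof.
intros Ha. induction k as [|k IH]; simpl; [lra|].
apply Rmult_lt_0_compat; [easy|]. pose proof (pos_INR k). lra.
Qed.

Lemma pochhammer_le (a b : R) (k : nat) : 0 < a <= b -> pochhammer a k <= pochhammer b k.
Proof.
intros H. induction k as [|k IH]; simpl; [lra|].
pose proof (pos_INR k). pose proof (pochhammer_pos a k).
apply Rmult_le_compat; lra.
Qed.

(** The coefficient of y^k in (1 + y)^(-c). *)
Definition neg_binom (c : R) (k : nat) : R := (-1) ^ k * (pochhammer c k / pochhammer 1 k).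

Lemma neg_binom_succ (c : R) (k : nat) :
  INR (S k) * neg_binom c (S k) = - ((INR k + c) * neg_binom c k).
Proof.
unfold neg_binom. rewrite S_INR. simpl. pose proof (pos_INR k). pose proof (pochhammer_pos 1 k).
field. lra.
Qed.

Lemma neg_binom_abs_le1 (c : R) (k : nat) : 0 < c <= 1 -> Rabs (neg_binom c k) <= 1.
Proof.
intros Hc. unfold neg_binom. rewrite Rabs_mult pow_1_abs Rmult_1_l.
pose proof (pochhammer_pos 1 k Rlt_0_1). pose proof (pochhammer_pos c k (proj1 Hc)).
rewrite Rabs_pos_eq.
- apply Rle_div_l; [easy|]. rewrite Rmult_1_l. now apply pochhammer_le.
- apply Rlt_le, Rdiv_lt_0_compat; easy.
Qed.

Definition neg_binom_sum (c : R) (n : nat) (y : R) : R :=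
  sum_n (fun k => neg_binom c k * y ^ k) n.

Lemma sum_n_succ_R (u : nat -> R) (n : nat) : sum_n u (S n) = sum_n u n + u (S n).
Proof. apply (sum_Sn (G := R_AbelianMonoid)). Qed.

Lemma is_derive_Rplus (f g : R -> R) (x df dg : R) :
  is_derive f x df -> is_derive g x dg -> is_derive (fun t => f t + g t) x (df + dg).
Proof. apply (is_derive_plus f g). Qed.

(** For the partial sum S, the coefficient recurrence makes (1 + y) S' + c S telescope to its top
    term. *)
Lemma is_derive_neg_binom_sum (c : R) (n : nat) (y : R) : 0 < 1 + y ->
  is_derive (neg_binom_sum c n) y
    (((INR n + c) * neg_binom c n * y ^ n - c * neg_binom_sum c n y) / (1 + y)).
Proof.
intros Hy. unfold neg_binom_sum. induction n as [|n IH].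
- apply is_derive_ext with (f := fun _ => 1).
  { intros t. rewrite sum_O. unfold neg_binom. simpl. field. }
  rewrite sum_O. unfold neg_binom. evar_last; [apply: is_derive_const|].
  unfold zero; simpl. field. lra.
- apply is_derive_ext with (f := fun t => sum_n (fun k => neg_binom c k * t ^ k) n
                                      + neg_binom c (S n) * t ^ S n).
  { intros t. symmetry. apply sum_n_succ_R. }
  evar_last.
  + apply is_derive_Rplus; [apply IH|].
    apply is_derive_scal, is_derive_pow, is_derive_id.
  + rewrite sum_n_succ_R.
    generalize (sum_n (fun k : nat => neg_binom c k * y ^ k) n); intros s.
    rewrite -(Ropp_involutive ((INR n + c) * neg_binom c n)) -neg_binom_succ.
    unfold one; simpl (pred _); rewrite -tech_pow_Rmult; simpl Ring.one.
    rewrite S_INR. field. lra.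
Qed.

(* The derivative of (1 + y)^c times the partial sum is a single monomial times (1 + y)^(c - 1). *)
Lemma neg_binom_sum_error (c y : R) (n : nat) : 0 < c <= 1 -> 0 <= y ->
  Rabs (Rpower (1 + y) (- c) - neg_binom_sum c n y) <= INR (S n) * y ^ S n.
Proof.
intros Hc Hy.
set (f := fun t => Rpower (1 + t) c * neg_binom_sum c n t).
set (df := fun t => Rpower (1 + t) c / (1 + t) * ((INR n + c) * neg_binom c n * t ^ n)).
assert (Hf : forall t, 0 <= t -> is_derive f t (df t)).
{ intros t Ht. unfold f, df. evar_last.
  - apply is_derive_Rmult.
    + instantiate (1 := c / (1 + t) * Rpower (1 + t) c).
      unfold Rpower. auto_derive; [lra|field; lra].
    + apply is_derive_neg_binom_sum. lra.
  - cbv beta. field. lra. }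
(* As f 0 = 1, the difference f y - f 0 is the error times -(1 + y)^c, so a bound on [df]
   suffices. *)
destruct (MVT_gen f 0 y df) as [t [[Ht0 Ht1] E]].
- intros x [Hx _]. apply Hf. rewrite Rmin_left in Hx; lra.
- intros x [Hx _]. apply continuity_pt_filterlim. apply (continuous_of_is_derive f x (df x)).
  apply Hf. rewrite Rmin_left in Hx; lra.
- rewrite Rmin_left in Ht0; [|easy]. rewrite Rmax_right in Ht1; [|easy].
  assert (E0 : f 0 = 1).
  { unfold f. rewrite Rplus_0_r. unfold Rpower. rewrite ln_1 Rmult_0_r exp_0 Rmult_1_l. unfold neg_binom_sum.
    clear. induction n as [|n IH].
    - rewrite sum_O. unfold neg_binom. simpl. field.
    - rewrite sum_n_succ_R IH. rewrite pow_ne_zero //. ring. }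
  assert (Hb : forall s, 0 <= s -> 0 < Rpower (1 + s) (- c) <= 1).
  { intros s Hs. split; [apply exp_pos|].
    apply Rle_trans with (Rpower (1 + s) 0); [apply Rle_Rpower; lra|].
    rewrite Rpower_O; lra. }
  assert (Hd : Rabs (df t) <= INR (S n) * y ^ n).
  { unfold df. rewrite Rabs_mult (Rabs_mult (_ * _) (t ^ n)) (Rabs_mult (INR n + c)).
    assert (Hq : Rabs (Rpower (1 + t) c / (1 + t)) <= 1).
    { assert (0 < Rpower (1 + t) c) by apply exp_pos.
      rewrite Rabs_pos_eq; [|apply Rlt_le, Rdiv_lt_0_compat; lra].
      apply Rle_div_l; [lra|]. rewrite Rmult_1_l.
      apply Rle_trans with (Rpower (1 + t) 1); [apply Rle_Rpower; lra|].
      rewrite Rpower_1; lra. }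
    pose proof (pos_INR n).
    rewrite (Rabs_pos_eq (INR n + c)); [|lra]. rewrite (Rabs_pos_eq (t ^ n)); [|now apply pow_le].
    pose proof (neg_binom_abs_le1 c n Hc). rewrite S_INR.
    assert (t ^ n <= y ^ n) by now apply pow_incr.
    assert (0 <= t ^ n) by now apply pow_le.
    pose proof (Rabs_pos (neg_binom c n)).
    rewrite -(Rmult_1_l ((INR n + 1) * y ^ n)).
    apply Rmult_le_compat; [apply Rabs_pos| |easy|].
    - apply Rmult_le_pos; [|easy]. apply Rmult_le_pos; lra.
    - apply Rmult_le_compat; [apply Rmult_le_pos; lra|easy| |easy].
      rewrite -(Rmult_1_r (INR n + 1)). apply Rmult_le_compat; lra. }
  replace (Rpower (1 + y) (- c) - neg_binom_sum c n y)
    with (- (Rpower (1 + y) (- c) * (f y - f 0))).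
  2: { rewrite E0. unfold f. rewrite Rpower_Ropp. field. apply Rgt_not_eq, exp_pos. }
  rewrite Rabs_Ropp Rabs_mult E Rabs_mult Rminus_0_r (Rabs_pos_eq y) //.
  rewrite Rabs_pos_eq; [|apply Rlt_le, Hb; lra].
  rewrite -(Rmult_1_l (INR (S n) * y ^ S n)).
  apply Rmult_le_compat; [apply Rlt_le, Hb; lra| |apply Hb; lra|].
  + apply Rmult_le_pos; [apply Rabs_pos|easy].
  + simpl (y ^ S n). replace (INR (S n) * (y * y ^ n)) with (INR (S n) * y ^ n * y) by ring.
    apply Rmult_le_compat_r; easy.
Qed.

(** * The terms of the series as combinations of moments *)

Definition term (k : nat) : R :=
  (- (1 / 4)) ^ k
  * (pochhammer (1 / 8) k * pochhammer (5 / 8) k * pochhammer (3 / 4) k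
     / (pochhammer (7 / 8) k * pochhammer 1 k * pochhammer (11 / 8) k))
  * (40 * INR k + 9).

Lemma moment_0 : moment 0 = RInt phi 0 1.
Proof. apply RInt_ext_R. intros x _. simpl. ring. Qed.

(** Iterating the recurrence gives (1/4)_(2k) / (3/4)_(2k), where (3/4)_(2k) = 4^k (3/8)_k (7/8)_k.
    The factor (8k + 3)/3 comes from replacing (3/8)_k by (11/8)_k. *)
Lemma moment_double (k : nat) :
  moment (2 * k) * (pochhammer (7 / 8) k * pochhammer (11 / 8) k)
  = moment 0 * (pochhammer (1 / 8) k * pochhammer (5 / 8) k * ((8 * INR k + 3) / 3)).
Proof.
induction k as [|k IH]; [simpl; field|].
pose proof (moment_recurrence (2 * k)) as E0.
pose proof (moment_recurrence (S (2 * k))) as E1.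
replace (2 * S k)%nat with (S (S (2 * k))) by lia.
rewrite S_INR mult_INR in E1. rewrite mult_INR in E0. simpl (INR 2) in *.
pose proof (pos_INR k).
rewrite S_INR. simpl pochhammer.
apply (Rmult_eq_reg_l ((8 * INR k + 3) * (8 * INR k + 7))); [|nra].
transitivity (((8 * INR k + 7) * moment (S (S (2 * k))))
  * ((8 * INR k + 3) * (pochhammer (7 / 8) k * pochhammer (11 / 8) k * ((7 / 8 + INR k) * (11 / 8 + INR k))))); [ring|].
replace ((8 * INR k + 7) * moment (S (S (2 * k)))) with ((8 * INR k + 5) * moment (S (2 * k))) by lra.
transitivity (((8 * INR k + 3) * moment (S (2 * k)))
  * ((8 * INR k + 5) * (pochhammer (7 / 8) k * pochhammer (11 / 8) k * ((7 / 8 + INR k) * (11 / 8 + INR k))))); [ring|].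
replace ((8 * INR k + 3) * moment (S (2 * k))) with ((8 * INR k + 1) * moment (2 * k)) by lra.
transitivity ((8 * INR k + 1) * (8 * INR k + 5) * ((7 / 8 + INR k) * (11 / 8 + INR k))
  * (moment (2 * k) * (pochhammer (7 / 8) k * pochhammer (11 / 8) k))); [ring|].
rewrite IH. field.
Qed.

(** The origin of 40k + 9: by the recurrence the combination is 3 (8k + 1)/(8k + 3) + 2 = (40k +
    9)/(8k + 3) times [moment (2 * k)], and 8k + 3 cancels against [moment_double]. *)
Lemma moment_term (k : nat) :
  neg_binom (3 / 4) k * (/ 4) ^ k * (3 * moment (S (2 * k)) + 2 * moment (2 * k))
  = moment 0 / 3 * term k.
Proof.
pose proof (moment_recurrence (2 * k)) as E0. rewrite mult_INR in E0. simpl (INR 2) in E0.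
pose proof (moment_double k) as E. pose proof (pos_INR k).
pose proof (pochhammer_pos (7 / 8) k ltac:(lra)).
pose proof (pochhammer_pos (11 / 8) k ltac:(lra)).
pose proof (pochhammer_pos 1 k ltac:(lra)).
assert (E1 : 3 * moment (S (2 * k)) + 2 * moment (2 * k)
   = (40 * INR k + 9) / (8 * INR k + 3) * moment (2 * k)).
{ apply (Rmult_eq_reg_l (8 * INR k + 3)); [|lra].
  transitivity ((40 * INR k + 9) * moment (2 * k)); [lra|field; lra]. }
rewrite E1. clear E0 E1.
replace (moment (2 * k)) with (moment 0 * (pochhammer (1 / 8) k * pochhammer (5 / 8) k * ((8 * INR k + 3) / 3))
   / (pochhammer (7 / 8) k * pochhammer (11 / 8) k)) by (rewrite -E; field; lra).
unfold term, neg_binom. replace (- (1 / 4)) with (-1 * / 4) by field.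
rewrite Rpow_mult_distr. field. lra.
Qed.

Lemma is_RInt_partial_sum (n : nat) :
  is_RInt (fun r => (3 * amp r + 2) * neg_binom_sum (3 / 4) n (amp r ^ 2 / 4) * phi r) 0 1
    (moment 0 / 3 * sum_n term n).
Proof.
assert (Hk : forall k, is_RInt (fun r => (3 * amp r + 2) * (neg_binom (3 / 4) k * (amp r ^ 2 / 4) ^ k) * phi r)
    0 1 (moment 0 / 3 * term k)).
{ intros k. rewrite -moment_term.
  apply is_RInt_ext with (f := fun r => (neg_binom (3 / 4) k * (/ 4) ^ k)
     * (3 * (amp r ^ S (2 * k) * phi r) + 2 * (amp r ^ (2 * k) * phi r))).
  - intros r _. match goal with |- @eq _ ?a ?b => change (@eq R a b) end.
    rewrite -(tech_pow_Rmult (amp r) (2 * k)) pow_mult.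
    change (amp r ^ 2 / 4) with (amp r ^ 2 * / 4). rewrite (Rpow_mult_distr (amp r ^ 2)). ring.
  - apply: is_RInt_scal. apply: is_RInt_plus; apply: is_RInt_scal; apply is_RInt_moment. }
induction n as [|n IH].
- rewrite sum_O. apply is_RInt_ext with (2 := Hk 0%nat).
  intros r _. unfold neg_binom_sum. now rewrite sum_O.
- rewrite sum_n_succ_R Rmult_plus_distr_l.
  eapply is_RInt_ext; [|apply: is_RInt_plus; [apply IH|apply (Hk (S n))]].
  intros r _. unfold neg_binom_sum. rewrite sum_n_succ_R.
  match goal with |- @eq _ ?a ?b => change (@eq R a b) end.
  unfold plus; simpl. ring.
Qed.

(** * Error of the partial sums and convergence *)

Lemma moment_0_pos : 0 < moment 0.
Proof.
rewrite moment_0. apply RInt_gt_0; [lra| |].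
- intros; apply phi_pos.
- intros; apply continuous_phi.
Qed.

Lemma phi_le1 (r : R) : phi r <= 1.
Proof.
pose proof (phi_pos r). pose proof (pow2_phi r) as E.
assert (H1 : / (1 + r ^ 4) <= / 1).
{ apply Rinv_le_contravar; [lra|]. pose proof (pow2_ge_0 (r ^ 2)). nra. }
nra.
Qed.

Lemma root_pow3 (x : R) : root x ^ 3 = Rpower (1 + x ^ 2 / 4) (- (3 / 4)).
Proof.
unfold root. rewrite -Rpower_pow; [|apply exp_pos]. rewrite Rpower_mult.
f_equal. simpl. field.
Qed.

(** For x = [amp r] in [0, 1], 3 x + 2 <= 5 and [phi] <= 1, while the binomial series is taken at
    x^2/4 <= 1/4. *)
Lemma partial_sum_error (n : nat) :
  Rabs (2 * sqrt 2 * moment 0 - moment 0 / 3 * sum_n term n) <= 5 * (INR (S n) * (/ 4) ^ S n).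
Proof.
assert (H : is_RInt (fun r => integrand r - (3 * amp r + 2) * neg_binom_sum (3 / 4) n (amp r ^ 2 / 4) * phi r)
  0 1 (2 * sqrt 2 * moment 0 - moment 0 / 3 * sum_n term n)).
{ apply: is_RInt_minus; [|apply is_RInt_partial_sum].
  rewrite moment_0 -RInt_integrand. apply: RInt_correct.
  apply ex_RInt_of_continuous, continuous_integrand. }
rewrite -(is_RInt_unique (V := R_CompleteNormedModule) _ _ _ _ H).
replace (5 * (INR (S n) * (/ 4) ^ S n)) with ((1 - 0) * (5 * (INR (S n) * (/ 4) ^ S n))) by ring.
apply abs_RInt_le_const; [lra|eexists; apply H|].
intros r _. unfold integrand. rewrite root_pow3.
pose proof (amp_ge0 r). pose proof (amp_le1 r). pose proof (phi_pos r). pose proof (phi_le1 r).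
pose proof (pow2_ge_0 (amp r)).
pose proof (neg_binom_sum_error (3 / 4) (amp r ^ 2 / 4) n ltac:(lra) ltac:(lra)) as E.
assert (E' : (amp r ^ 2 / 4) ^ S n <= (/ 4) ^ S n) by (apply pow_incr; nra).
replace ((3 * amp r + 2) * Rpower (1 + amp r ^ 2 / 4) (- (3 / 4)) * phi r
  - (3 * amp r + 2) * neg_binom_sum (3 / 4) n (amp r ^ 2 / 4) * phi r)
 with ((3 * amp r + 2) * phi r * (Rpower (1 + amp r ^ 2 / 4) (- (3 / 4))
   - neg_binom_sum (3 / 4) n (amp r ^ 2 / 4))) by ring.
rewrite Rabs_mult. rewrite Rabs_pos_eq; [|nra].
apply Rmult_le_compat; [nra|apply Rabs_pos|nra|].
eapply Rle_trans; [apply E|]. apply Rmult_le_compat_l; [apply pos_INR|easy].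
Qed.

(** Crude, but it reduces n / 4^n to the geometric 1 / 2^n. *)
Lemma INR_le_pow2 (n : nat) : INR n <= 2 ^ n.
Proof.
induction n as [|n IH]; [simpl; lra|]. rewrite S_INR. simpl.
pose proof (pow_R1_Rle 2 n ltac:(lra)). lra.
Qed.

Theorem mainTheorem8 :
  is_series
    (fun k : nat =>
       (- (1 / 4)) ^ k
       * (pochhammer (1 / 8) k * pochhammer (5 / 8) k * pochhammer (3 / 4) k
          / (pochhammer (7 / 8) k * pochhammer 1 k * pochhammer (11 / 8) k))
       * (40 * INR k + 9))
    (6 * sqrt 2).
Proof.
change (is_lim_seq (sum_n term) (6 * sqrt 2)).
pose proof moment_0_pos as HL.
(* Dividing [partial_sum_error] by [moment 0 / 3] turns 2 sqrt 2 into 6 sqrt 2 and 5 into 15 /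
   [moment 0]. *)
assert (Hb : forall n, Rabs (sum_n term n - 6 * sqrt 2) <= 15 / moment 0 * (/ 2) ^ S n).
{ intros n. pose proof (partial_sum_error n) as E.
  replace (2 * sqrt 2 * moment 0 - moment 0 / 3 * sum_n term n)
    with (- (moment 0 / 3) * (sum_n term n - 6 * sqrt 2)) in E by field.
  rewrite Rabs_mult Rabs_Ropp (Rabs_pos_eq (moment 0 / 3)) in E; [|lra].
  assert (E2 : INR (S n) * (/ 4) ^ S n <= (/ 2) ^ S n).
  { replace (/ 4) with (/ 2 * / 2) by field. rewrite Rpow_mult_distr.
    pose proof (INR_le_pow2 (S n)). assert (0 < 2 ^ S n) by (apply pow_lt; lra).
    assert (0 < (/ 2) ^ S n) by (apply pow_lt; lra).
    assert (2 ^ S n * (/ 2) ^ S n = 1) by (rewrite -Rpow_mult_distr Rinv_r; [apply pow1|lra]).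
    nra. }
  apply (Rmult_le_reg_l (moment 0 / 3)); [lra|].
  replace (moment 0 / 3 * (15 / moment 0 * (/ 2) ^ S n)) with (5 * (/ 2) ^ S n) by (field; lra).
  lra. }
apply is_lim_seq_ext with (u := fun n => (sum_n term n - 6 * sqrt 2) + 6 * sqrt 2).
{ intros n. ring. }
replace (Finite (6 * sqrt 2)) with (Finite (0 + 6 * sqrt 2)) by (f_equal; ring).
apply is_lim_seq_plus'; [|apply is_lim_seq_const].
apply is_lim_seq_abs_0.
apply is_lim_seq_le_le with (u := fun _ => 0) (w := fun n => 15 / moment 0 * (/ 2) ^ S n).
- intros n. split; [apply Rabs_pos|apply Hb].
- apply is_lim_seq_const.
- replace (Finite 0) with (Rbar_mult (15 / moment 0) 0) by (simpl; f_equal; ring).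
  apply is_lim_seq_scal_l. apply (is_lim_seq_incr_1 (fun n => (/ 2) ^ n)).
  apply is_lim_seq_geom. rewrite Rabs_pos_eq; lra.
Qed.
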